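(* Let $K$ be a field and $x=(x_1,\dots,x_n)$ an $n$-tuple of variables. Suppose that $g = f_1(p/q)/f_2(p/q)$ for certain $p,q \in K[x]$ and $f_1, f_2 \in K[y_1] \setminus K$. If $p/q \notin K$, then the following hold. (i) $p/q$ is integral over $K[g]$ if and only if $\deg f_1 > \deg f_2$. (ii) There exist $p^{*},q^{*} \in K[x]$ with $K(p^{*}/q^{*}) = K(p/q)$ such that $p^{*}/q^{*}$ is integral over $K[g]$, if and only if either $\deg f_1 > \deg f_2$ or $f_2$ has a root in $K$ whose multiplicity as a root of $f_2$ is larger than its multiplicity as a root of $f_1$.
   Context: $y_1$ is a single variable. The multiplicity of $\theta\in K$ as a root of a polynomial is $0$ if $\theta$ is not a root. Quotients presuppose nonzero denominators. *)

(* Defs.v *)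
From HB Require Import structures.
From mathcomp Require Import all_boot all_order all_algebra.
From mathcomp Require Import mpoly.

Set Implicit Arguments.
Unset Strict Implicit.
Unset Printing Implicit Defensive.

Import GRing.Theory.
Local Open Scope ring_scope.

Section RationalFunctions.

Variables (K : fieldType) (n : nat).

Definition ratfun := {fraction {mpoly K[n]}}.

Definition ratC (c : K) : ratfun := tofrac (c%:MP : {mpoly K[n]}).

Definition quot (p q : {mpoly K[n]}) : ratfun := tofrac p / tofrac q.

Definition in_base (z : ratfun) : Prop := exists c : K, z = ratC c.

Definition peval (f : {poly K}) (z : ratfun) : ratfun :=
  (map_poly ratC f).[z].

(* The ring K[g] is the image of f |-> f(g), so the coefficients of an integral
   equation over K[g] are given by elements of {poly K} mapped to K(x).       *)
Definition integral_over_adjoin (g z : ratfun) : Prop :=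
  integralOver (fun f : {poly K} => peval f g) z.

(* w belongs to the subfield K(z) of K(x). *)
Definition in_adjoin_field (z w : ratfun) : Prop :=
  exists f h : {poly K}, peval h z != 0 /\ w = peval f z / peval h z.

Definition same_adjoin_field (z z' : ratfun) : Prop :=
  forall w : ratfun, in_adjoin_field z w <-> in_adjoin_field z' w.

End RationalFunctions.

(* Main.v *)
(** Put t = p/q.  Since t is not in K it is transcendental over K: after
    subtracting a multiple of q from p, the leading monomials of p and q differ,
    so all p^i q^(d-i) have distinct leading monomials.  An integral equation of
    a(t)/b(t) over K[g] thus becomes, after clearing denominators, the polynomial
    identity a^m f2^N + sum_(i<m) C_i a^i b^(m-i) = 0, where C_i is homogeneous of
    degree N in f1, f2.  Comparing degrees when b = 1 gives (i).  If
    K(a(t)/b(t)) = K(t) with a, b coprime, then b divides a nonzero polynomial of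
    degree at most 1; so either b is constant, which reduces to a degree
    comparison, or b has a root theta in K, and evaluating the identity at theta,
    with the common factors X - theta of f1 and f2 removed, bounds the
    multiplicities.  Conversely 1/(t - theta) is integral over K[g] when theta
    has larger multiplicity in f2 than in f1. *)
Require Import Defs.
From HB Require Import structures.
From mathcomp Require Import all_boot all_order all_algebra.
From mathcomp Require Import mpoly.
From mathcomp Require Import zify ring.

Set Implicit Arguments.
Unset Strict Implicit.
Unset Printing Implicit Defensive.

Import GRing.Theory.
Local Open Scope ring_scope.

(** * Binary forms evaluated in a commutative algebra *)

(** The degree [d] homogenization of [c] at [(a, b)], that is [b^d c(a/b)] without division.
    Coefficients of [c] above index [d] would be dropped, whence the bounds [size c <= d.+1]. *)
Definition binform (K : fieldType) (A : comAlgType K) (d : nat) (c : {poly K})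
    (a b : A) : A :=
  \sum_(i < d.+1) c`_i *: (a ^+ i * b ^+ (d - i)).

Lemma rmorph_binform (K L : fieldType) (A : comAlgType K)
    (iota : {rmorphism K -> L}) (phi : {rmorphism A -> L})
    (phi_alg : forall k : K, phi k%:A = iota k)
    (d : nat) (c : {poly K}) (a b : A) :
  (size c <= d.+1)%N -> phi b != 0 ->
  phi (binform d c a b) = phi b ^+ d * (map_poly iota c).[phi a / phi b].
Proof.
move=> szc b0; rewrite (@horner_coef_wide _ d.+1) ?size_map_poly //.
rewrite rmorph_sum mulr_sumr; apply: eq_bigr => i _.
rewrite -mulr_algl !rmorphM !rmorphXn /= phi_alg coef_map /=.
have id : (i <= d)%N by rewrite -ltnS.
have -> : phi b ^+ d = phi b ^+ (d - i) * phi b ^+ i by rewrite -exprD subnK.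
rewrite expr_div_n [RHS]mulrCA; congr (_ * _).
by rewrite -mulrA [_ ^+ i * (_ / _)]mulrC divfK ?expf_neq0 // mulrC.
Qed.

Lemma size_binform (K : fieldType) (d : nat) (c a b : {poly K}) :
  (size a <= size b)%N -> (size (binform d c a b) <= size (b ^+ d))%N.
Proof.
move=> ab; apply: leq_trans (size_sum _ _ _) _; apply/bigmax_leqP => i _.
apply: leq_trans (size_scale_leq _ _) _.
have id : (i <= d)%N by rewrite -ltnS.
have [b0|b0] := eqVneq b 0.
  move: ab; rewrite b0 size_poly0 leqn0 size_poly_eq0 => /eqP->.
  by rewrite -exprD subnKC.
have [a0|a0] := eqVneq (a ^+ i) 0; first by rewrite a0 mul0r size_poly0.
have -> : b ^+ d = b ^+ i * b ^+ (d - i) by rewrite -exprD subnKC.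
suff le_ab : (size (a ^+ i) <= size (b ^+ i))%N.
  by rewrite !(size_mul, a0, expf_neq0) // -!subn1 leq_sub2r ?leq_add2r.
have le_pred : ((size a).-1 <= (size b).-1)%N by rewrite -!subn1 leq_sub2r.
have := leq_mul2r i (size a).-1 (size b).-1; rewrite le_pred orbT -!size_exp -!subn1.
by rewrite leq_subLR subn1 add1n prednK // lt0n size_poly_eq0 expf_neq0.
Qed.

(** Only the term of index [d] lacks a factor [b]. *)
Lemma dvdp_binform_sub (K : fieldType) (d : nat) (c a b : {poly K}) :
  b %| binform d c a b - c`_d *: a ^+ d.
Proof.
rewrite /binform big_ord_recr /= subnn expr0 mulr1 addrK.
apply: (big_ind (fun u => b %| u)) => [|u v|i _];
  rewrite ?dvdp0 //; first exact: dvdp_add.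
  by rewrite scalerAr -mul_polyC !dvdp_mull // dvdp_exp // subn_gt0.
Qed.

(** The largest leading monomial occurs in exactly one summand, so nothing cancels its
    coefficient. *)
Lemma sum_distinct_mlead_neq0 (R : nzRingType) (n : nat) (I : finType)
    (P : pred I) (F : I -> {mpoly R[n]}) (i0 : I) :
  P i0 -> (forall i, P i -> F i != 0) ->
  {in P &, injective (fun i => mlead (F i))} ->
  \sum_(i | P i) F i != 0.
Proof.
move=> Pi0 F0 injF.
case: (Order.TotalTheory.arg_maxP (fun i => mlead (F i)) Pi0) => j Pj maxj.
apply/eqP => /(congr1 (mcoeff (mlead (F j)))).
rewrite (bigD1 j) //= mcoeffD mcoeff0 raddf_sum /= big1 ?addr0.
  by move/eqP; rewrite mleadc_eq0 (negPf (F0 j Pj)).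
move=> i /andP[Pi ij]; apply: mcoeff_gt_mlead.
rewrite Order.POrderTheory.lt_neqAle; apply/andP; split; last exact: maxj.
by apply: contraNneq ij => /injF ->.
Qed.

(** In some variable [k] the leading exponents [x] of [a] and [y] of [b] differ. The leading
    exponent of [a^i b^(d-i)] there is [i x + (d-i) y], which determines [i]; so the terms with
    nonzero coefficient have distinct leading monomials. *)
Lemma binform_mpoly_neq0 (K : fieldType) (n d : nat) (c : {poly K})
    (a b : {mpoly K[n]}) :
  a != 0 -> b != 0 -> mlead a != mlead b -> c != 0 -> (size c <= d.+1)%N ->
  binform d c a b != 0.
Proof.
move=> a0 b0 ab c0 szc.
have [k abk] : exists k, mlead a k != mlead b k.
  apply/existsP; rewrite -negb_forall; apply: contra ab => /forallP ab.
  by apply/eqP/mnmP => k; apply/eqP.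
have -> : binform d c a b = \sum_(i < d.+1 | c`_i != 0) c`_i *: (a ^+ i * b ^+ (d - i)).
  rewrite /binform [RHS]big_mkcond; apply: eq_bigr => i _.
  by case: eqVneq => //= ->; rewrite scale0r.
have lt_d : ((size c).-1 < d.+1)%N.
  by rewrite prednK // lt0n size_poly_eq0.
apply: (@sum_distinct_mlead_neq0 _ _ _ _ _ (Ordinal lt_d)).
- by rewrite /= -lead_coefE lead_coef_eq0.
- by move=> i ci; rewrite scaler_eq0 mulf_eq0 !expf_eq0 (negPf ci) (negPf a0) (negPf b0) !andbF.
move=> i j ci cj; rewrite !mleadZ // !mleadM ?expf_neq0 // !mleadX //.
move=> /mnmP/(_ k); rewrite !mnmDE !mulmnE => eqij.
apply/val_inj => /=.
have := ltn_ord i; have := ltn_ord j; rewrite !ltnS => jd id.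
move/eqP: abk eqij; move: (mlead a k) (mlead b k) => x y.
nia.
Qed.

(** * Evaluation of polynomials over K in an extension field *)

Section Evaluation.

Variables (K L : fieldType) (iota : {rmorphism K -> L}).

Definition evalp (z : L) (f : {poly K}) : L := (map_poly iota f).[z].

HB.instance Definition _ (z : L) :=
  GRing.RMorphism.copy (evalp z) (horner_eval z \o map_poly iota).

Definition transcendental (z : L) : Prop :=
  forall f : {poly K}, evalp z f = 0 -> f = 0.

Lemma evalpC (z : L) (k : K) : evalp z k%:P = iota k.
Proof. by rewrite /evalp map_polyC hornerC. Qed.

Lemma evalpX (z : L) : evalp z 'X = z.
Proof. by rewrite /evalp map_polyX hornerX. Qed.

Lemma evalpZ (z : L) (k : K) (f : {poly K}) :
  evalp z (k *: f) = iota k * evalp z f.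
Proof. by rewrite -mul_polyC rmorphM /= evalpC. Qed.

Lemma evalp_alg (z : L) (k : K) : evalp z k%:A = iota k.
Proof. by rewrite evalpZ rmorph1 mulr1. Qed.

Lemma evalp_neq0 (z : L) (f : {poly K}) :
  transcendental z -> f != 0 -> evalp z f != 0.
Proof. by move=> tr; apply: contra_neq => /tr. Qed.

Lemma evalp_binform (z : L) (d : nat) (c a b : {poly K}) :
  (size c <= d.+1)%N -> evalp z b != 0 ->
  evalp z (binform d c a b) =
    evalp z b ^+ d * evalp (evalp z a / evalp z b) c.
Proof. by apply: rmorph_binform; exact: evalp_alg. Qed.

(** * Integrality over K[g] and generators of K(t) *)

Lemma integral_of_relation (u v : {poly K}) (g s : L) :
  (size v < size u)%N -> evalp s u = g * evalp s v -> integralOver (evalp g) s.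
Proof.
move=> vu uv.
have u0 : lead_coef u != 0 by rewrite lead_coef_eq0 -size_poly_gt0 (leq_trans _ vu).
pose lift : {poly K} -> {poly {poly K}} := map_poly polyC.
have lift_eval f : (map_poly (evalp g) (lift f)).[s] = evalp s f.
  rewrite /lift -map_poly_comp /evalp; congr (_.[s]); apply: eq_map_poly => k /=.
  exact: evalpC.
have szlift f : size (lift f) = size f by rewrite size_map_inj_poly //; exact: polyC_inj.
(* The scalar ['X] is the variable of the coefficient ring and stands for [g]. As [v] has smaller
   degree, the leading coefficient is that of [u], a constant that can be inverted. *)
exists ((lead_coef u)^-1%:P *: (lift u - 'X *: lift v)).
  rewrite monicE lead_coefZ lead_coefDl; last first.
    by rewrite size_polyN (leq_ltn_trans (size_scale_leq _ _)) // !szlift.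
  rewrite lead_coef_map_inj //; last exact: polyC_inj.
  by rewrite -polyCM mulVf.
rewrite /root -!mul_polyC rmorphM rmorphB rmorphM /= !map_polyC /=.
by rewrite !(hornerM, hornerD, hornerN, hornerC) !lift_eval evalpX uv subrr mulr0.
Qed.

Lemma integral_equation (t : L) (f1 f2 a b : {poly K}) :
  transcendental t -> f2 != 0 -> b != 0 ->
  integralOver (evalp (evalp t f1 / evalp t f2)) (evalp t a / evalp t b) ->
  exists (m N : nat) (c : nat -> {poly K}),
    a ^+ m * f2 ^+ N + \sum_(i < m) binform N (c i) f1 f2 * a ^+ i * b ^+ (m - i) = 0.
Proof.
move=> tr f20 b0 [P monP /rootP].
set g := evalp t f1 / _; set z := evalp t a / _.
have Ef20 := evalp_neq0 tr f20; have Eb0 := evalp_neq0 tr b0.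
have szP : size P = (size P).-1.+1 by rewrite prednK // size_poly_gt0 monic_neq0.
set m := (size P).-1 in szP.
rewrite (@horner_coef_wide _ m.+1) ?(leq_trans (size_poly _ _)) ?szP //.
rewrite big_ord_recr /= !coef_map /=.
have -> : P`_m = 1 by rewrite -(monicP monP) lead_coefE.
rewrite rmorph1 mul1r => Pz.
(* [N] bounds all coefficients, so they are homogenized to one common degree; multiplying by
   [f2(t)^N b(t)^m] then clears every denominator. *)
pose N := \max_(i < m) size (P`_i)%R.
exists m, N, (fun i => P`_i); apply: tr.
rewrite rmorphD rmorphM !rmorphXn rmorph_sum /=.
transitivity (evalp t f2 ^+ N * evalp t b ^+ m *
    (\sum_(i < m) (map_poly (evalp g) P)`_i * z ^+ i + z ^+ m));
  last by rewrite Pz mulr0.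
rewrite addrC mulrDr; congr (_ + _); last first.
  by rewrite /z expr_div_n mulrC -mulrA; congr (_ * _); rewrite mulrC divfK ?expf_neq0.
rewrite mulr_sumr; apply: eq_bigr => i _.
rewrite !rmorphM !rmorphXn /= evalp_binform //; last first.
  by rewrite ltnW // ltnS (leq_bigmax (F := fun j : 'I_m => size (P`_j)%R)).
rewrite coef_map /= -!mulrA; congr (_ * _).
rewrite [RHS]mulrCA; congr (_ * _).
have -> : evalp t b ^+ m = evalp t b ^+ (m - i) * evalp t b ^+ i.
  by rewrite -exprD subnK // ltnW.
by rewrite /z expr_div_n -mulrA [_ ^+ i * (_ / _)]mulrC divfK ?expf_neq0 // mulrC.
Qed.

(** If [deg f1 <= deg f2], each form has degree at most that of [f2^N], so [a^m f2^N] strictly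
    dominates the other terms of the integral equation and cannot cancel. *)
Lemma integral_size_lt (t : L) (f1 f2 a : {poly K}) :
  transcendental t -> f2 != 0 -> (1 < size a)%N ->
  integralOver (evalp (evalp t f1 / evalp t f2)) (evalp t a) ->
  (size f2 < size f1)%N.
Proof.
move=> tr f20 a1; rewrite -[evalp t a]divr1 -(rmorph1 (evalp t)) => int.
have [m [N [c]]] := integral_equation tr f20 (oner_neq0 _) int.
rewrite ltnNge => eq0; apply/negP => le12.
have a0 : a != 0 by rewrite -size_poly_gt0 ltnW.
suff /size_polyDl : (size (\sum_(i < m) binform N (c i) f1 f2 * a ^+ i * 1 ^+ (m - i))%R
    < size (a ^+ m * f2 ^+ N)%R)%N.
  rewrite eq0 size_poly0 => /esym/eqP.
  by rewrite size_poly_eq0 mulf_eq0 !expf_eq0 (negPf a0) (negPf f20) !andbF.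
apply: leq_ltn_trans (size_sum _ _ _) _.
rewrite -(prednK (n := size (a ^+ m * _))); last first.
  by rewrite size_poly_gt0 mulf_neq0 ?expf_neq0.
rewrite ltnS; apply/bigmax_leqP => i _.
rewrite expr1n mulr1; apply: leq_trans (size_polyMleq _ _) _.
rewrite size_mul ?expf_neq0 // -!subn1 leq_sub2r //.
suff lt_a : (size (a ^+ i) < size (a ^+ m))%N.
  rewrite leq_subRL ?addn_gt0 ?size_poly_gt0 ?expf_neq0 // addnCA addnC.
  by rewrite add1n leq_add // size_binform.
have gt0 : (0 < size (a ^+ m))%N by rewrite size_poly_gt0 expf_neq0.
rewrite -(prednK gt0) ltnS.
apply: leq_trans (leqSpred _) _.
by rewrite !size_exp ltn_pmul2l ?ltn_ord // -subn1 subn_gt0.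
Qed.

Lemma integral_mup_lt (t : L) (f1 f2 a b : {poly K}) (theta : K) :
  transcendental t -> f1 != 0 -> f2 != 0 -> b != 0 ->
  root b theta -> ~~ root a theta ->
  integralOver (evalp (evalp t f1 / evalp t f2)) (evalp t a / evalp t b) ->
  (mup theta f1 < mup theta f2)%N.
Proof.
move=> tr f10 f20 b0 bth ath int; rewrite ltnNge; apply/negP => le21.
have /dvdpP[h1 f1E] : ('X - theta%:P) ^+ mup theta f2 %| f1 by rewrite -mup_geq.
have [k [h2]] := multiplicity_XsubC f2 theta; rewrite f20 /= => h2th f2E.
have kE : mup theta f2 = k by rewrite f2E mupMr // mup_XsubCX eqxx.
rewrite kE in f1E.
have Xk0 : evalp t (('X - theta%:P) ^+ k) != 0.
  by rewrite evalp_neq0 // expf_neq0 // polyXsubC_eq0.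
have h20 : h2 != 0 by apply: contraNneq h2th => ->; rewrite root0.
have gE : evalp t f1 / evalp t f2 = evalp t h1 / evalp t h2.
  by rewrite f1E f2E !rmorphM -mulf_div divff // mulr1.
rewrite gE in int.
have [m [N [c]]] := integral_equation tr h20 b0 int.
(* At [theta] every term with a positive power of [b] vanishes, leaving
   [a(theta)^m h2(theta)^N = 0]. *)
move/(congr1 (horner^~ theta)); rewrite hornerD hornerM !horner_exp horner_sum horner0.
rewrite big1 ?addr0 => [/eqP|i _]; last first.
  by rewrite !hornerM !horner_exp (rootP bth) expr0n subn_eq0 leqNgt ltn_ord mulr0.
by rewrite mulf_eq0 !expf_eq0 -!/(root _ _) (negPf ath) (negPf h2th) !andbF.
Qed.

Lemma evalp_comp (z : L) (f h : {poly K}) :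
  evalp z (f \Po h) = evalp (evalp z h) f.
Proof. by rewrite /evalp map_comp_poly horner_comp. Qed.

(** This form is the reversal [X^d c(1/X)], whose coefficient of [X^d] is [c_0]. *)
Lemma size_binform1X (d : nat) (c : {poly K}) :
  (c`_0 != 0 -> size (binform d c 1 'X) = d.+1) /\
  (c`_0 = 0 -> (size (binform d c 1 'X) <= d)%N).
Proof.
pose r : {poly K} := \sum_(i < d) c`_(bump 0 i) *: (1 ^+ bump 0 i * 'X ^+ (d - bump 0 i)).
have le_r : (size r <= d)%N.
  apply: leq_trans (size_sum _ _ _) _; apply/bigmax_leqP => i _.
  rewrite expr1n mul1r (leq_trans (size_scale_leq _ _)) // size_polyXn.
  by rewrite /bump /= add1n -subSn ?ltn_ord // subSS leq_subr.
have -> : binform d c 1 'X = c`_0 *: 'X^d + r.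
  by rewrite /binform big_ord_recl subn0 expr0 mul1r.
split => [c0|->].
  by rewrite size_polyDl size_scale // size_polyXn.
by rewrite scale0r add0r.
Qed.

(* In terms of s = 1/(t - theta), clearing denominators in f1(t) = g f2(t) leaves
   a relation u(s) = g v(s) with deg v < deg u. *)
Lemma integral_inv (t : L) (f1 f2 : {poly K}) (theta : K) :
  transcendental t -> f1 != 0 -> f2 != 0 -> (mup theta f1 < mup theta f2)%N ->
  integralOver (evalp (evalp t f1 / evalp t f2)) (t - iota theta)^-1.
Proof.
move=> tr f10 f20.
have [m1 [h1]] := multiplicity_XsubC f1 theta; rewrite f10 /= => h1th f1E.
have [m2 [h2]] := multiplicity_XsubC f2 theta; rewrite f20 /= => h2th f2E.
have -> : mup theta f1 = m1 by rewrite f1E mupMr // mup_XsubCX eqxx.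
have -> : mup theta f2 = m2 by rewrite f2E mupMr // mup_XsubCX eqxx.
move=> lt12; set s := (t - _)^-1; set g := evalp t f1 / _.
have wE : evalp t ('X - theta%:P) = s^-1 by rewrite rmorphB /= evalpX evalpC /s invrK.
have w0 : s^-1 != 0 by rewrite -wE evalp_neq0 // polyXsubC_eq0.
have tE : t = evalp s^-1 ('X + theta%:P).
  by rewrite rmorphD /= evalpX evalpC /s invrK subrK.
have h20 : evalp t h2 != 0.
  by rewrite evalp_neq0 //; apply: contraNneq h2th => ->; rewrite root0.
(* With [w = t - theta], these rewrite [f1(t) = g f2(t)] as [k1(w) = g k2(w)] after cancelling
   [w^m1]. *)
pose k1 := h1 \Po ('X + theta%:P).
pose k2 := (h2 \Po ('X + theta%:P)) * 'X ^+ (m2 - m1).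
have kE : evalp s^-1 k1 = g * evalp s^-1 k2.
  rewrite /k1 /k2 rmorphM rmorphXn /= evalpX !evalp_comp -tE.
  rewrite /g f1E f2E !rmorphM !rmorphXn /= wE.
  have -> : s^-1 ^+ m2 = s^-1 ^+ m1 * s^-1 ^+ (m2 - m1).
    by rewrite -exprD subnKC // ltnW.
  have := expf_neq0 m1 w0; have := expf_neq0 (m2 - m1) w0.
  move: (s^-1 ^+ m1) (s^-1 ^+ (m2 - m1)) => x y y0 x0.
  by field; rewrite h20 x0 y0.
pose d := maxn (size k1) (size k2).
have ev_bin (k : {poly K}) : (size k <= d)%N ->
    evalp s (binform d k 1 'X) = s ^+ d * evalp s^-1 k.
  move=> szk; rewrite evalp_binform ?leqW // evalpX ?rmorph1 ?div1r //.
  by rewrite -invr_eq0.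
apply: (@integral_of_relation (binform d k1 1 'X) (binform d k2 1 'X)).
  (* [k1(0) = h1(theta)] is nonzero while [k2(0) = 0] since [m1 < m2]; after reversal only the first
     has full degree [d]. *)
  have k10 : k1`_0 != 0 by rewrite -horner_coef0 horner_comp !hornerE.
  rewrite ((size_binform1X d k1).1 k10) ltnS; apply: (size_binform1X d k2).2.
  by rewrite -horner_coef0 hornerM hornerXn expr0n subn_eq0 leqNgt lt12 mulr0.
by rewrite !ev_bin ?leq_maxl ?leq_maxr // kE mulrCA.
Qed.

(* With C, D the forms of degree d of c and e at (a, b), t D = C; modulo b this
   reads (e_d X - c_d) a^d = 0, so b divides e_d X - c_d. *)
Lemma generator_sizes (t z : L) (a b c e : {poly K}) :
  transcendental t -> coprimep a b -> b != 0 -> z = evalp t a / evalp t b ->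
  evalp z e != 0 -> t = evalp z c / evalp z e ->
  (size b <= 2)%N /\ ((size b <= 1)%N -> (1 < size a)%N).
Proof.
move=> tr cop b0 zE ez0 tE.
have e0 : e != 0 by apply: contraNneq ez0 => ->; rewrite rmorph0.
pose d := (maxn (size c) (size e)).-1.
have dS : d.+1 = maxn (size c) (size e).
  by rewrite prednK // leq_max !size_poly_gt0 e0 orbT.
have ev_bin (k : {poly K}) : (size k <= d.+1)%N ->
    evalp t (binform d k a b) = evalp t b ^+ d * evalp z k.
  by move=> szk; rewrite evalp_binform ?evalp_neq0 // zE.
have szc : (size c <= d.+1)%N by rewrite dS leq_maxl.
have sze : (size e <= d.+1)%N by rewrite dS leq_maxr.
have rel : 'X * binform d e a b = binform d c a b.
  apply/eqP; rewrite -subr_eq0; apply/eqP/tr.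
  rewrite rmorphB rmorphM /= evalpX !ev_bin // {1}tE mulrCA divfK //.
  by rewrite subrr.
split.
  pose l := e`_d *: 'X - (c`_d)%:P.
  have l0 : l != 0.
    (* By the choice of [d], the coefficients [c_d] and [e_d] cannot both vanish. *)
    apply/eqP => /polyP l0.
    have cd : c`_d = 0.
      by have := l0 0; rewrite /l !coefE mulr0 sub0r => /eqP; rewrite oppr_eq0 => /eqP.
    have ed : e`_d = 0 by have := l0 1; rewrite /l !coefE mulr1 subr0.
    have : (maxn (size c) (size e) <= d)%N.
      rewrite geq_max; apply/andP; split; apply/leq_sizeP => j.
        by rewrite leq_eqVlt => /predU1P[<- //|dj]; apply: nth_default (leq_trans _ dj).
      by rewrite leq_eqVlt => /predU1P[<- //|dj]; apply: nth_default (leq_trans _ dj).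
    by rewrite -dS ltnn.
  have : b %| l.
    have cop_ba : coprimep b (a ^+ d) by rewrite coprimep_expr // coprimep_sym.
    rewrite -(Gauss_dvdpr _ cop_ba).
    have -> : a ^+ d * l = 'X * (e`_d *: a ^+ d - binform d e a b) +
        (binform d c a b - c`_d *: a ^+ d).
      by rewrite -rel /l -!mul_polyC; ring.
    by rewrite dvdp_addr ?dvdp_binform_sub // dvdp_mull // -opprB dvdpNr dvdp_binform_sub.
  move/dvdp_leq => /(_ l0)/leq_trans; apply.
  rewrite /l (leq_trans (size_polyD _ _)) // geq_max size_polyN.
  rewrite (leq_trans (size_scale_leq _ _)) ?size_polyX //.
  exact: leq_trans (size_polyC_leq1 _) _.
(* If [a] and [b] were both constant, so would be both forms, contradicting [X D = C] with [D]
   nonzero. *)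
move=> b1; rewrite ltnNge; apply/negP => a1.
have szb : size b = 1 by apply/eqP; rewrite eqn_leq b1 size_poly_gt0.
have szbin k : (size (binform d k a b) <= 1)%N.
  apply: leq_trans (size_binform _ _ _) _; first by rewrite szb.
  by rewrite (leq_trans (size_poly_exp_leq _ _)) // szb.
have be0 : binform d e a b != 0.
  apply/eqP => be0; have := ev_bin _ sze; rewrite be0 rmorph0 => /esym/eqP.
  by rewrite mulf_eq0 expf_eq0 (negPf (evalp_neq0 tr b0)) andbF (negPf ez0).
move: (szbin c); rewrite -rel mulrC size_mulX //.
by rewrite ltnS leqn0 size_poly_eq0 (negPf be0).
Qed.

(** * The subfields K(z) and the two equivalences for transcendental t *)

Definition in_adjoin (z w : L) : Prop :=
  exists f h : {poly K}, evalp z h != 0 /\ w = evalp z f / evalp z h.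

Lemma in_adjoin_refl (z : L) : in_adjoin z z.
Proof.
by exists 'X, 1; rewrite rmorph1 evalpX divr1 oner_neq0.
Qed.

(** Numerator and denominator are homogenized to the same degree [d], so the factor [b^d] cancels in
    the quotient. *)
Lemma in_adjoin_trans (t z w : L) :
  in_adjoin t z -> in_adjoin z w -> in_adjoin t w.
Proof.
move=> [a [b [b0 zE]]] [f [h [h0 wE]]]; pose d := maxn (size f) (size h).
have ev_bin (k : {poly K}) : (size k <= d)%N ->
    evalp t (binform d k a b) = evalp t b ^+ d * evalp z k.
  by move=> szk; rewrite evalp_binform ?leqW // zE.
have bd0 : evalp t b ^+ d != 0 by rewrite expf_neq0.
exists (binform d f a b), (binform d h a b).
rewrite !ev_bin ?leq_maxl ?leq_maxr // mulf_neq0 //; split=> //.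
by rewrite -mulf_div divff // mul1r.
Qed.

Lemma in_adjoin_inv (t : L) (theta : K) :
  t != iota theta -> in_adjoin t (t - iota theta)^-1.
Proof.
move=> tth; exists 1, ('X - theta%:P).
by rewrite rmorph1 rmorphB /= evalpX evalpC div1r subr_eq0.
Qed.

Lemma in_adjoin_of_inv (t : L) (theta : K) :
  t != iota theta -> in_adjoin (t - iota theta)^-1 t.
Proof.
move=> tth; have w0 : t - iota theta != 0 by rewrite subr_eq0.
exists (theta *: 'X + 1), 'X.
rewrite rmorphD rmorph1 /= evalpZ evalpX invr_eq0; split=> //.
by rewrite invrK mulrDl mul1r divfK // addrC subrK.
Qed.

Lemma coprime_fraction (t : L) (a b : {poly K}) :
  evalp t b != 0 -> exists a' b' : {poly K},
    [/\ coprimep a' b', b' != 0 &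
        evalp t a / evalp t b = evalp t a' / evalp t b'].
Proof.
move=> bt0.
have b0 : b != 0 by apply: contraNneq bt0 => ->; rewrite rmorph0.
have aE := divpK (dvdp_gcdl a b); have bE := divpK (dvdp_gcdr a b).
exists (a %/ gcdp a b), (b %/ gcdp a b); split.
- by rewrite coprimep_div_gcd // b0 orbT.
- by apply: contraNneq b0 => b'0; rewrite -bE b'0 mul0r.
have aEt : evalp t a = evalp t (a %/ gcdp a b) * evalp t (gcdp a b).
  by rewrite -rmorphM aE.
have bEt : evalp t b = evalp t (b %/ gcdp a b) * evalp t (gcdp a b).
  by rewrite -rmorphM bE.
move: bt0; rewrite bEt mulf_eq0 negb_or => /andP[_ g0].
by rewrite aEt -mulf_div divff // mulr1.
Qed.

Lemma integral_iff (t : L) (f1 f2 : {poly K}) :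
  transcendental t -> f2 != 0 ->
  integralOver (evalp (evalp t f1 / evalp t f2)) t <-> (size f2 < size f1)%N.
Proof.
move=> tr f20; split=> [|lt21].
  rewrite -[X in integralOver _ X](evalpX t).
  by apply: integral_size_lt => //; rewrite size_polyX.
(* The relation is [f1(t) = g f2(t)] itself. *)
apply: (integral_of_relation lt21).
by rewrite divfK // evalp_neq0.
Qed.

Lemma integral_generator (t z : L) (f1 f2 : {poly K}) :
  transcendental t -> f1 != 0 -> f2 != 0 -> in_adjoin t z -> in_adjoin z t ->
  integralOver (evalp (evalp t f1 / evalp t f2)) z ->
  (size f2 < size f1)%N \/
    exists theta : K, root f2 theta /\ (mup theta f1 < mup theta f2)%N.
Proof.
move=> tr f10 f20 [a0 [b0 [b0t zE]]] [c [e [ez0 tE]]] int.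
have [a [b [cop bn0 fracE]]] := coprime_fraction a0 b0t.
rewrite fracE in zE.
have [szb sza] := generator_sizes tr cop bn0 zE ez0 tE.
rewrite zE in int.
have [szb1|szb1] := leqP (size b) 1.
  have bE := size1_polyC szb1.
  have b00 : (b`_0)^-1 != 0 by rewrite invr_eq0 -polyC_eq0 -bE.
  (* A constant [b] is absorbed into [a], making [z] a nonconstant polynomial in [t]. *)
  left; apply: (integral_size_lt (t := t) (a := (b`_0)^-1 *: a)) => //.
    by rewrite size_scale ?sza.
  by rewrite evalpZ fmorphV [X in integralOver _ X]mulrC -(evalpC t) -bE.
right.
have szb2 : size b = 2 by apply/eqP; rewrite eqn_leq szb.
have [theta bth] := poly2_root szb2.
have ath : ~~ root a theta.
  by apply: contraL bth => ath; exact: coprimep_root cop ath.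
have lt_mup := integral_mup_lt tr f10 f20 bn0 bth ath int.
exists theta; split=> //.
by rewrite -dvdp_XsubCl XsubC_dvd // (leq_ltn_trans _ lt_mup).
Qed.

End Evaluation.

(** * Rational functions in n variables *)

HB.instance Definition _ (K : fieldType) (n : nat) :=
  GRing.RMorphism.copy (@ratC K n) (@tofrac {mpoly K[n]} \o @mpolyC n K).

Lemma quot_transcendental (K : fieldType) (n : nat) (p q : {mpoly K[n]}) :
  q != 0 -> ~ in_base (quot p q) -> transcendental (@ratC K n) (quot p q).
Proof.
move=> q0 notK f.
(* This [c] removes the monomial [mlead q] from [r = p - c q], so [r] and [q] have different leading
   monomials; [r] is nonzero because [p/q] is not constant. *)
pose c := p@_(mlead q) / mleadc q; pose r := p - c *: q.
have tq0 : tofrac q != 0 by rewrite tofrac_eq0.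
have tcq : tofrac (c *: q) = ratC n c * tofrac q by rewrite -mul_mpolyC rmorphM.
have qE : quot p q = quot r q + ratC n c.
  by rewrite /quot rmorphB /= tcq mulrBl mulfK // subrK.
have r0 : r != 0.
  apply/eqP => r0; apply: notK; exists c.
  by rewrite qE r0 /quot rmorph0 mul0r add0r.
have rq : mlead r != mlead q.
  apply/eqP => rq; move: r0; rewrite -mleadc_eq0 rq mcoeffB mcoeffZ divfK ?subrr ?eqxx //.
  by rewrite mleadc_eq0.
(* The shift by [c] turns [f(p/q)] into [h(r/q)], whose numerator is a nonzero form in [r] and
   [q]. *)
pose h := f \Po ('X + c%:P).
have hE : evalp (@ratC K n) (quot r q) h = evalp (@ratC K n) (quot p q) f.
  by rewrite evalp_comp rmorphD /= evalpX evalpC -qE.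
rewrite -hE => h0; apply/eqP; apply: contraT => f0.
have hn0 : h != 0 by rewrite /h comp_poly_eq0 // size_XaddC.
have /negP[] := binform_mpoly_neq0 r0 q0 rq hn0 (leqnSn _).
pose phi : {rmorphism {mpoly K[n]} -> ratfun K n} := @tofrac {mpoly K[n]}.
have alg k : phi k%:A = ratC n k by rewrite alg_mpolyC.
rewrite -tofrac_eq0.
have -> := rmorph_binform (iota := @ratC K n) alg r (leqnSn (size h)) tq0.
by rewrite /= -/(quot r q) -/(evalp _ _ _) h0 mulr0.
Qed.

Lemma quot_sub_inv (K : fieldType) (n : nat) (p q : {mpoly K[n]}) (theta : K) :
  q != 0 -> quot p q != ratC n theta ->
  p - theta *: q != 0 /\ quot q (p - theta *: q) = (quot p q - ratC n theta)^-1.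
Proof.
move=> q0; rewrite -subr_eq0.
have -> : quot p q - ratC n theta = quot (p - theta *: q) q.
  by rewrite /quot rmorphB mulrBl -mul_mpolyC rmorphM mulfK // tofrac_eq0.
move=> w0; split; last by rewrite /quot invf_div.
by apply: contraNneq w0 => ->; rewrite /quot rmorph0 mul0r.
Qed.

Theorem theorem3p4 (K : fieldType) (n : nat) (g : ratfun K n)
    (p q : {mpoly K[n]}) (f1 f2 : {poly K})
    (q_neq0 : q != 0)
    (f1_nonconst : ~ (exists c : K, f1 = c%:P))
    (f2_nonconst : ~ (exists c : K, f2 = c%:P))
    (f2pq_neq0 : peval f2 (quot p q) != 0)
    (g_def : g = peval f1 (quot p q) / peval f2 (quot p q))
    (pq_notin_K : ~ in_base (quot p q)) :
  (integral_over_adjoin g (quot p q) <-> (size f2 < size f1)%N)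
  /\
  ((exists p' q' : {mpoly K[n]},
      [/\ q' != 0,
          same_adjoin_field (quot p' q') (quot p q)
        & integral_over_adjoin g (quot p' q')])
   <->
   ((size f2 < size f1)%N \/
    exists theta : K, root f2 theta /\ (mup theta f1 < mup theta f2)%N)).
Proof.
pose iota : {rmorphism K -> ratfun K n} := @ratC K n.
have tr := quot_transcendental q_neq0 pq_notin_K.
have f10 : f1 != 0 by apply/eqP => f10; apply: f1_nonconst; exists 0.
have f20 : f2 != 0 by apply/eqP => f20; apply: f2_nonconst; exists 0.
have adjE z w : in_adjoin_field z w <-> in_adjoin iota z w by [].
have {}g_def : g = evalp iota (quot p q) f1 / evalp iota (quot p q) f2 by [].
have intE z : integral_over_adjoin g z <-> integralOver (evalp iota g) z by [].
have int_iff : integral_over_adjoin g (quot p q) <-> (size f2 < size f1)%N.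
  by apply: iff_trans (intE _) _; rewrite g_def; exact: integral_iff.
split=> //; split=> [[p' [q' [q'0 same int]]]|].
  move/(intE _).1: int; rewrite g_def => int.
  have tz : in_adjoin iota (quot p q) (quot p' q').
    exact: (adjE _ _).1 ((same _).1 ((adjE _ _).2 (in_adjoin_refl _ _))).
  have zt : in_adjoin iota (quot p' q') (quot p q).
    exact: (adjE _ _).1 ((same _).2 ((adjE _ _).2 (in_adjoin_refl _ _))).
  exact: integral_generator tr f10 f20 tz zt int.
case=> [lt21|[theta [_ lt_mup]]].
  by exists p, q; split=> //; apply/int_iff.
have tth : quot p q != iota theta by apply/eqP => tth; apply: pq_notin_K; exists theta.
have [r0 rE] := quot_sub_inv q_neq0 tth.
(* The new generator is [1/(p/q - theta)], written as a quotient of polynomials. *)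
exists q, (p - theta *: q); split=> //; rewrite rE.
  move=> w; split=> wK; apply: (adjE _ _).2.
    exact: in_adjoin_trans (in_adjoin_inv tth) ((adjE _ _).1 wK).
  exact: in_adjoin_trans (in_adjoin_of_inv tth) ((adjE _ _).1 wK).
by apply: (intE _).2; rewrite g_def; exact: (integral_inv tr f10 f20 lt_mup).
Qed.
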